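(* Let $\alpha\in[0,1)$ and let $T$ be a directed tree with $n$ vertices. Then $$\alpha^2(n-1)\leq E^{A_\alpha}(T)\leq\alpha^2(n-1)^2.$$ Moreover, $E^{A_\alpha}(T)=\alpha^2(n-1)^2$ if and only if $T$ is an outstar, and $E^{A_\alpha}(T)=\alpha^2(n-1)$ if and only if $T$ is an intree.
   Context: Digraphs are finite, have no loops and no two arcs with the same tail and the same head (pairs of opposite arcs are allowed). A digraph is connected if its underlying undirected graph is connected. A directed tree is a connected digraph with $n$ vertices and $n-1$ arcs. An outstar is a directed tree with one vertex of outdegree $n-1$ and all other vertices of outdegree $0$. An intree is a connected digraph with no pair of opposite arcs, in which every vertex has outdegree at most one, and whose underlying undirected graph is a tree. For a digraph $G$ on vertices $v_1,\dots,v_n$, $A(G)$ is the adjacency matrix, $d_i^+$ the outdegree of $v_i$, $D(G)=\mathrm{diag}(d_1^+,\dots,d_n^+)$, $A_\alpha(G)=\alpha D(G)+(1-\alpha)A(G)$, and $E^{A_\alpha}(G)=\sum_{i=1}^n(\lambda_i^\alpha)^2$ where $\lambda_1^\alpha,\dots,\lambda_n^\alpha$ are the eigenvalues of $A_\alpha(G)$ with algebraic multiplicity.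
   Formalization: The two equality characterizations (outstar, intree) are stated only for α > 0, since at α = 0 the energy and both bounds are 0 for every directed tree, so the ''only if'' directions fail (e.g. the directed path on 3 vertices is not an outstar); the bounds are stated for all α in [0,1). *)

(* Defs.v *)
From HB Require Import structures.
From mathcomp Require Import all_boot all_order all_algebra.
From mathcomp Require Import reals complex.

Set Implicit Arguments.
Unset Strict Implicit.
Unset Printing Implicit Defensive.

Import Order.TTheory GRing.Theory Num.Theory.

Local Open Scope ring_scope.
Local Open Scope complex_scope.

Record digraph (n : nat) := Digraph {
  arc : rel 'I_n;
  arc_irr : irreflexive arc
}.

Section Digraph.
Variables (n : nat) (G : digraph n).

Definition arcs : {set 'I_n * 'I_n} := [set p | arc G p.1 p.2].

Definition outdeg (u : 'I_n) : nat := #|[set v | arc G u v]|.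

Definition underlying : rel 'I_n := [rel u v | arc G u v || arc G v u].

(* The digraph on no vertices is not connected. *)
Definition connected_digraph : Prop :=
  (0 < n)%N /\ forall u v, connect underlying u v.

Definition directed_tree : Prop :=
  connected_digraph /\ #|arcs| = n.-1.

Definition outstar : Prop :=
  directed_tree /\
  exists v, outdeg v = n.-1 /\ forall w, w != v -> outdeg w = 0%N.

(* The symmetric relation [underlying] admits the two-vertex closed walk u, v
   along any edge; genuine cycles of a simple graph have at least three
   vertices. *)
Definition underlying_acyclic : Prop :=
  forall c : seq 'I_n, ucycle underlying c -> (size c < 3)%N.

Definition underlying_tree : Prop :=
  (0 < n)%N /\ (forall u v, connect underlying u v) /\ underlying_acyclic.

Definition intree : Prop :=
  [/\ connected_digraph,
      forall u v, ~~ (arc G u v && arc G v u),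
      forall u, (outdeg u <= 1)%N
    & underlying_tree].

Variable R : realType.

Definition adjacency_mx : 'M[R]_n := \matrix_(i, j) (arc G i j)%:R.

Definition outdeg_mx : 'M[R]_n := diag_mx (\row_i (outdeg i)%:R).

Definition Aalpha (alpha : R) : 'M[R]_n :=
  alpha *: outdeg_mx + (1 - alpha) *: adjacency_mx.

End Digraph.

(* The complex roots of the characteristic polynomial, repeated according to
   algebraic multiplicity. *)
Definition eigenvalues (R : realType) (n : nat) (A : 'M[R]_n) : seq R[i] :=
  sval (closed_field_poly_normal (char_poly (map_mx (real_complex R) A))).

(* The eigenvalues, hence the energy, are complex numbers; for x, y in R[i],
   x <= y means that y - x is a nonnegative real. *)
Definition Aalpha_energy (R : realType) (n : nat) (G : digraph n) (alpha : R)
    : R[i] :=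
  \sum_(z <- eigenvalues (Aalpha G alpha)) z ^+ 2.

(* Main.v *)
(* The sum of the squared eigenvalues of A_alpha is the trace of its square.  A
   connected digraph on n vertices needs at least n - 1 arcs, so in a directed
   tree no arc can be deleted without losing connectedness.  Hence there are no
   opposite arcs, which reduces the trace to alpha^2 times the sum of the squared
   outdegrees, and no underlying cycles.  The outdegrees are natural numbers of
   sum s = n - 1, and d <= d^2 <= d s for each of them, with equality on the left
   iff d <= 1 and on the right iff d is 0 or s. *)
Require Import Defs.
From HB Require Import structures.
From mathcomp Require Import all_boot all_order all_algebra.
From mathcomp Require Import reals complex spectral.

Import Order.TTheory GRing.Theory Num.Theory.

Local Open Scope ring_scope.
Local Open Scope complex_scope.

(* [path.arc] shadows the arc relation of digraphs. *)
Local Notation arc := Defs.arc.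

(** * Eigenvalues and traces *)

(** The constant matrix [P] also intertwines X - A and X - B; taking determinants, the nonzero
    constant [\det P'] cancels. *)
Lemma char_poly_intertwined (F : fieldType) (n : nat) (P A B : 'M[F]_n) :
  P \in unitmx -> P *m A = B *m P -> char_poly A = char_poly B.
Proof.
move=> uP PA; pose P' := map_mx polyC P.
have detP' : \det P' != 0.
  by rewrite det_map_mx polyC_eq0 -unitfE -unitmxE.
apply: (mulfI detP'); rewrite /char_poly -det_mulmx mulrC -det_mulmx.
congr (\det _); rewrite /char_poly_mx mulmxBr mulmxBl.
by rewrite -!map_mxM PA scalar_mxC.
Qed.

Lemma mxtrace_sqr_trig (F : comNzRingType) (n : nat) (A : 'M[F]_n) :
  is_trig_mx A -> \tr (A *m A) = \sum_i A i i ^+ 2.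
Proof.
move=> /is_trig_mxP trA; apply: eq_bigr => i _; rewrite mxE (bigD1 i) //=.
rewrite big1 ?addr0 ?expr2 // => j; rewrite -(inj_eq val_inj) /= neq_ltn.
by case/orP=> /trA->; rewrite ?mul0r ?mulr0.
Qed.

(** Over the complex numbers the matrix is similar to a triangular one, whose diagonal lists the
    eigenvalues; similarity preserves the trace of the square and the characteristic polynomial. *)
Lemma sum_sqr_eigenvalues {R : realType} (n : nat) (A : 'M[R]_n) :
  \sum_(z <- eigenvalues A) z ^+ 2 = (\tr (A *m A))%:C.
Proof.
rewrite /eigenvalues; case: closed_field_poly_normal => s /= def_s.
rewrite -[RHS]/(real_complex R _) -trace_map_mx map_mxM; set B := map_mx _ A in def_s *.
have [P uP] : exists2 P : 'M[R[i]]_n, P \in unitmx & is_trig_mx (P *m B *m invmx P).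
  case: (n) B {def_s} => [|m] B.
    by exists 1%:M; rewrite ?unitmx1 //; apply/is_trig_mxP => -[].
  have [P /unitarymx_unit uP trP] := Schur B (ltn0Sn m).
  by exists P => //; rewrite -mxred.conjumx.
set D := P *m B *m invmx P => trD.
have PB : P *m B = D *m P by rewrite /D mulmxKV.
have -> : \tr (B *m B) = \tr (D *m D).
  by rewrite /D !mulmxA mulmxKV // [RHS]mxtrace_mulC !mulmxA mulVmx // mul1mx.
rewrite (mxtrace_sqr_trig _ _ _ trD) -(big_map (fun i => D i i) xpredT (fun x => x ^+ 2)).
(* Two lists with the same product of factors X - z are permutations of each other. *)
apply: perm_big; apply: prod_XsubC_eq; rewrite big_map.
transitivity (char_poly B).
  by rewrite [RHS]def_s (monicP (char_poly_monic _)) scale1r.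
by rewrite (char_poly_intertwined _ _ _ _ _ uP PB) char_poly_trig // big_enum.
Qed.

Section Trees.
Variable n : nat.
Implicit Types (G : digraph n) (u v : 'I_n).

(** Off-diagonal terms of the trace contain the indicators of two opposite arcs and vanish; without
    loops, the diagonal entries are alpha times the outdegrees. *)
Lemma Aalpha_energy_antisym {R : realType} G (alpha : R) :
    (forall u v, ~~ (arc G u v && arc G v u)) ->
  Aalpha_energy G alpha = (alpha ^+ 2 * (\sum_u outdeg G u ^ 2)%:R)%:C.
Proof.
move=> asymG; rewrite /Aalpha_energy sum_sqr_eigenvalues; congr (_%:C).
rewrite natr_sum mulr_sumr; apply: eq_bigr => u _.
rewrite mxE (bigD1 u) //= big1 => [|v neq_vu].
  rewrite addr0 !mxE !eqxx arc_irr mulr0 addr0 mulr1n natrX -exprMn.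
  by rewrite expr2.
rewrite !mxE (negPf neq_vu) eq_sym (negPf neq_vu) !mulr0n !mulr0 !add0r.
by rewrite mulrACA -natrM mulnb (negPf (asymG u v)) mulr0.
Qed.

Lemma sum_outdeg G : (\sum_u outdeg G u)%N = #|arcs G|.
Proof.
rewrite -sum1_card.
rewrite (eq_bigl (fun p => true && arc G p.1 p.2)); last by move=> p; rewrite inE.
rewrite -(pair_big_dep xpredT (arc G) (fun _ _ => 1%N)) /=.
by apply: eq_bigr => u _; rewrite sum1_card /outdeg cardsE.
Qed.

Lemma underlying_connect_sym G : connect_sym (underlying G).
Proof. by apply: sym_connect_sym => u v; rewrite /underlying /= orbC. Qed.

(** * Minimality of directed trees *)

(** A vertex set grown from [r] one vertex at a time gains at least one inner arc with each new
    vertex. *)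
Lemma connected_arcs_ge G : connected_digraph G -> (n.-1 <= #|arcs G|)%N.
Proof.
move=> [n_gt0 conG]; pose inner (S : {set 'I_n}) := arcs G :&: setX S S.
pose r := Ordinal n_gt0.
have grow k : (k < n)%N ->
    exists S : {set 'I_n}, [/\ r \in S, #|S| = k.+1 & (k <= #|inner S|)%N].
  elim: k => [_|k IHk lt_k1n]; first by exists [set r]; rewrite set11 cards1.
  have [S [rS cardS le_k]] := IHk (ltnW lt_k1n).
  have [x xS] : exists x, x \notin S.
    apply/existsP; rewrite -negb_forall; apply: contraL lt_k1n => /forallP allS.
    rewrite -leqNgt -cardS -[leqLHS]card_ord; apply/subset_leq_card/subsetP.
    by move=> x _; apply: allS.
  (* A path from [r] to a vertex outside [S] has a step that leaves [S]. *)
  have [u [v [uS vS uv]]] : exists u v, [/\ u \in S, v \notin S & underlying G u v].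
    have /connectP[p] := conG r x.
    elim: p (r) rS => [|y p IHp] z zS /= => [_ eq_x|/andP[zy py] last_x].
      by rewrite eq_x zS in xS.
    by have [yS|yS] := boolP (y \in S); [apply: IHp yS py last_x | exists z, y].
  exists (v |: S); split; first by rewrite setU1r.
    by rewrite cardsU1 vS cardS.
  rewrite (leq_ltn_trans le_k) //; apply: proper_card; apply/properP; split.
    by rewrite setIS // setXS // subsetUr.
  have [vu|vu] := orP uv; [exists (u, v) | exists (v, u)];
    by rewrite !inE /= vu ?eqxx ?uS ?(negPf vS) ?orbT ?andbF.
have [|S [_ _ /leq_trans]] := grow n.-1; first by rewrite prednK.
by apply; rewrite subset_leq_card // subsetIl.
Qed.

Lemma tree_subgraph_eq G H :
  directed_tree G -> connected_digraph H -> subrel (arc H) (arc G) ->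
  arc H =2 arc G.
Proof.
move=> [_ cardG] conH subHG u v.
suff /setP/(_ (u, v)) : arcs H = arcs G by rewrite !inE.
apply/eqP; rewrite eqEcard cardG connected_arcs_ge // andbT.
by apply/subsetP=> p; rewrite !inE; apply: subHG.
Qed.

(** [D] may contain pairs that are not arcs, so both orientations of an underlying edge can be
    removed without knowing which is present. *)
Definition del_arcs G (D : {set 'I_n * 'I_n}) : digraph n :=
  @Digraph n [rel u v | arc G u v && ((u, v) \notin D)]
    (fun u => introF idP (fun H => elimF idP (arc_irr G u) (andP H).1)).

Lemma del_arcs_connected G (D : {set 'I_n * 'I_n}) :
    connected_digraph G ->
    (forall u v, (u, v) \in D -> connect (underlying (del_arcs G D)) u v) ->
  connected_digraph (del_arcs G D).
Proof.
move=> [n_gt0 conG] conD; split=> // u v; apply: connect_sub (conG u v) => {u v}.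
have sub u v : arc G u v -> connect (underlying (del_arcs G D)) u v.
  move=> uv; have [/conD//|notD] := boolP ((u, v) \in D).
  by apply: connect1; rewrite /underlying /= uv notD.
by move=> u v /orP[/sub//|/sub]; rewrite underlying_connect_sym.
Qed.

(** If the ends of every pair in [D] stay joined, the remaining digraph is connected, so by
    minimality no arc was deleted. *)
Lemma tree_del_arcs G (D : {set 'I_n * 'I_n}) u v :
    directed_tree G ->
    (forall x y, (x, y) \in D -> connect (underlying (del_arcs G D)) x y) ->
  (u, v) \in D -> ~~ arc G u v.
Proof.
move=> treeG conD Duv; have conH := del_arcs_connected _ _ treeG.1 conD.
rewrite -(tree_subgraph_eq G (del_arcs G D) treeG conH) /= ?Duv ?andbF //.
by move=> x y /andP[].
Qed.

Lemma tree_antisym G : directed_tree G -> forall u v, ~~ (arc G u v && arc G v u).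
Proof.
move=> treeG u v; apply/negP=> /andP[uv vu].
suff /negP[] : ~~ arc G u v by [].
apply: (tree_del_arcs G [set (u, v)]) (set11 _) => // x y /set1P[-> ->].
(* The opposite arc still joins the two ends; it differs from the deleted one because there are no
   loops. *)
apply: connect1; rewrite /underlying /= !inE vu !xpair_eqE.
by have [eq_vu|] := eqVneq v u; [rewrite eq_vu arc_irr in vu | rewrite orbT].
Qed.

(** Remove the edge between the first two vertices x, y of a cycle, in both orientations: the rest
    of the cycle still joins y to x, against minimality. *)
Lemma tree_acyclic G : directed_tree G -> underlying_acyclic G.
Proof.
move=> treeG [|x [|y [|z c]]] //= /andP[/=].
rewrite !inE !negb_or => /and3P[xy yz path_zx] /and3P[/and3P[nxy nxz _]].
move=> /andP[nyz y_c] _; pose D := [set (x, y); (y, x)].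
have conyx : connect (underlying (del_arcs G D)) y x.
  apply/connectP; exists (z :: rcons c x); last by rewrite /= last_rcons.
  have keep u v : underlying G u v -> (u, v) \notin D -> (v, u) \notin D ->
    underlying (del_arcs G D) u v by rewrite /underlying /= => uv -> ->; rewrite !andbT.
  rewrite [path _ _ _]/= -[X in X && _]/(underlying (del_arcs G D) y z).
  apply/andP; split.
    apply: keep yz _ _;
      by rewrite !inE !xpair_eqE ![z == _]eq_sym (negPf nxz) (negPf nyz) ?andbF.
  (* From [z] on the walk avoids [y], which belongs to both deleted pairs. *)
  apply: (sub_in_path (P := predC1 y)) path_zx => [u v|].
    rewrite !inE => uy vy uv; apply: keep uv _ _;
      by rewrite !inE !xpair_eqE (negPf uy) (negPf vy) ?andbF.
  rewrite /= all_rcons /= nxy [z == y]eq_sym nyz /=.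
  by apply/allP=> w wc; apply: contraNneq y_c => <-.
have conD u v : (u, v) \in D -> connect (underlying (del_arcs G D)) u v.
  by rewrite !inE !xpair_eqE => /orP[]/andP[/eqP-> /eqP->] //; rewrite underlying_connect_sym.
have := xy; rewrite /underlying /= (negPf (tree_del_arcs _ _ _ _ treeG conD (set21 _ _))).
by rewrite (negPf (tree_del_arcs _ _ _ _ treeG conD (set22 _ _))).
Qed.

End Trees.

(** * Sums of squares *)

Lemma leqif_sum_sqr (I : finType) (d : I -> nat) :
  (\sum_i d i <= \sum_i d i ^ 2 ?= iff [forall i, d i <= 1])%N.
Proof.
apply: (leqif_sum (P := xpredT)) => i _; apply/leqifP.
by case: (d i) => [|[|k]] //=; rewrite ltn_Pmulr.
Qed.

Lemma sqr_sum_leqif (I : finType) (d : I -> nat) (s := (\sum_i d i)%N) :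
  (\sum_i d i ^ 2 <= s ^ 2 ?= iff [forall i, (d i == 0) || (d i == s)])%N.
Proof.
rewrite -[(s ^ 2)%N]mulnn {1}/s big_distrl /=.
apply: (leqif_sum (P := xpredT)) => i _; rewrite -mulnn.
have le_ds : (d i <= s)%N by rewrite /s (bigD1 i) //= leq_addr.
by split; [rewrite leq_mul2l le_ds orbT | rewrite eqn_mul2l].
Qed.

(** For outdegrees this yields the centre of an outstar; when [s] is 0, any index serves. *)
Lemma sum_concentrated (I : finType) (d : I -> nat) (s := (\sum_i d i)%N) :
  (0 < #|I|)%N -> (forall i, (d i == 0)%N || (d i == s)) ->
  exists i, d i = s /\ forall j, j != i -> d j = 0%N.
Proof.
move=> /card_gt0P[i0 _] d_0s; have [s0|s_gt0] := posnP s.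
  exists i0; split=> [|j _]; last by apply/eqP; have := d_0s j; rewrite s0 orbb.
  by apply/eqP; have := d_0s i0; rewrite {1}s0; case: eqP => //= ->; rewrite s0.
have [i di] : exists i, d i != 0%N.
  apply/existsP; apply: contraTT s_gt0; rewrite negb_exists -eqn0Ngt => /forallP d0.
  by rewrite /s big1 // => i _; apply/eqP; rewrite -[_ == _]negbK.
exists i; have dis : d i = s by apply/eqP; have := d_0s i; rewrite (negPf di).
(* As [d i] is already the whole sum, [d i + d j <= s] forces [d j] to be 0. *)
split=> // j ji; apply/eqP; rewrite -leqn0 -(leq_add2l (d i)) addn0 {2}dis.
by rewrite /s (bigD1 i) //= (bigD1 j) //= addnA leq_addr.
Qed.

(** The equality cases assume alpha > 0: for alpha = 0 the energy and both bounds are 0 for every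
    directed tree. *)
Theorem theorem3p7 (R : realType) (alpha : R) (n : nat) (T : digraph n)
    (alpha_ge0 : 0 <= alpha) (alpha_lt1 : alpha < 1) (treeT : directed_tree T) :
  [/\ (alpha ^+ 2 * (n%:R - 1))%:C <= Aalpha_energy T alpha,
      Aalpha_energy T alpha <= (alpha ^+ 2 * (n%:R - 1) ^+ 2)%:C,
      0 < alpha ->
        (Aalpha_energy T alpha = (alpha ^+ 2 * (n%:R - 1) ^+ 2)%:C <-> outstar T)
    & 0 < alpha ->
        (Aalpha_energy T alpha = (alpha ^+ 2 * (n%:R - 1))%:C <-> intree T)].
Proof.
have [[n_gt0 conT] cardT] := treeT; have asymT := tree_antisym _ _ treeT.
have sumT : (\sum_u outdeg T u)%N = n.-1 by rewrite sum_outdeg.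
have := leqif_sum_sqr _ (outdeg T); have := sqr_sum_leqif _ (outdeg T).
rewrite sumT (Aalpha_energy_antisym _ _ _ asymT).
have -> : n%:R - 1 = n.-1%:R :> R by rewrite -{1}(prednK n_gt0) -natr1 addrK.
rewrite -natrX !lecR; set S := (\sum_u _ ^ 2)%N => [[leU eqU] [leL eqL]].
have eqR m k : 0 < alpha ->
    (alpha ^+ 2 * m%:R)%:C = (alpha ^+ 2 * k%:R)%:C <-> m == k.
  move=> alpha_gt0; split=> [|/eqP-> //].
  by case=> /(mulfI (lt0r_neq0 (exprn_gt0 2 alpha_gt0)))/eqP; rewrite eqr_nat.
split=> [||alpha_gt0|alpha_gt0].
- by rewrite ler_wpM2l ?sqr_ge0 // ler_nat.
- by rewrite ler_wpM2l ?sqr_ge0 // ler_nat.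
- rewrite (eqR _ _ alpha_gt0) eqU; split=> [/forallP d_0s|[_ [v [dv dw]]]].
    split=> //; rewrite -sumT; apply: sum_concentrated; first by rewrite card_ord.
    by rewrite sumT.
  apply/forallP=> w; have [->|/dw->//] := eqVneq w v.
  by rewrite dv eqxx orbT.
- rewrite (eqR _ _ alpha_gt0) eq_sym eqL; split=> [/forallP d_le1|[_ _ d_le1 _]].
    by split=> //; do 2?split=> //; apply: tree_acyclic.
  exact/forallP.
Qed.
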